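(* Let $\mathcal{S}$ be a unipotent numerical monoid in $G$. If $\mathcal{S}$ is irreducible, then $|\mathtt{F}_t(\mathcal{S})|=1$.
   Context: Setting: $n$ is a positive integer, $\mathbf{U}(n,\mathbb{C})$ is the group of upper triangular unipotent $n\times n$ complex matrices, and $G$ is a (Zariski) closed subgroup of it. $G_{\mathbb{Z}}$ is the group of matrices in $G$ with integer entries, and $G(\mathbb{N})$ is the monoid of matrices in $G_{\mathbb{Z}}$ all of whose entries lie in $\mathbb{N}=\{0,1,2,\dots\}$. Standing assumptions: the monoid $G(\mathbb{N})$ is finitely generated and $G_{\mathbb{Z}}$ is its group completion. $\mathbf{1}_n$ is the identity matrix; for $\mathcal{X}\subseteq G(\mathbb{N})$, $\mathcal{X}^*:=\mathcal{X}\setminus\{\mathbf{1}_n\}$; $A\mathcal{X}:=\{AX\mid X\in\mathcal{X}\}$, and similarly $\mathcal{X}A$. A unipotent numerical monoid in $G$ is a finitely generated submonoid $\mathcal{S}\subseteq G(\mathbb{N})$ (containing $\mathbf{1}_n$) such that $G(\mathbb{N})\setminus\mathcal{S}$ is finite. $\mathcal{S}$ is irreducible if there are no two unipotent numerical monoids $\mathcal{T}_1,\mathcal{T}_2$ in $G$, each properly containing $\mathcal{S}$, with $\mathcal{T}_1\cap\mathcal{T}_2=\mathcal{S}$. The two-sided Frobenius set is $\mathtt{F}_t(\mathcal{S}):=\{A\in G(\mathbb{N})\mid A\notin\mathcal{S}^*\text{ and }A\,G(\mathbb{N})^*\cup G(\mathbb{N})^*A\subseteq\mathcal{S}\}$.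 *)

(* Defs.v *)
From HB Require Import structures.
From mathcomp Require Import all_boot all_order all_algebra.
From mathcomp Require Import boolp classical_sets functions cardinality reals.
From mathcomp Require Import complex mpoly.

Set Implicit Arguments.
Unset Strict Implicit.
Unset Printing Implicit Defensive.

Import Order.TTheory GRing.Theory Num.Theory.
Local Open Scope ring_scope.
Local Open Scope complex_scope.
Local Open Scope classical_set_scope.

Section UnipotentMonoids.
Variables (R : realType) (n : nat).
Local Notation C := R[i].
Implicit Types (G S M X : set 'M[C]_n) (A B : 'M[C]_n).

Definition unipotent_upper : set 'M[C]_n :=
  [set A | (forall i, A i i = 1) /\ (forall i j : 'I_n, (j < i)%N -> A i j = 0)].

(* The n * n variables of the polynomials stand for the entries of the matrix,
   ordered as in [mxvec]. *)
Definition zariski_closed_in (U V : set 'M[C]_n) : Prop :=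
  exists P : set {mpoly C[n * n]},
    V = U `&` [set A | forall p, P p -> p.@[fun k => mxvec A 0 k] = 0].

Definition is_subgroup G : Prop :=
  [/\ G 1%:M,
      forall A B, G A -> G B -> G (A *m B) &
      forall A, G A -> A \in unitmx /\ G (invmx A)].

Definition closed_unipotent_subgroup G : Prop :=
  [/\ G `<=` unipotent_upper, is_subgroup G &
      zariski_closed_in unipotent_upper G].

Definition integer_points G : set 'M[C]_n :=
  [set A | G A /\ forall i j, exists z : int, A i j = z%:~R].

Definition natural_points G : set 'M[C]_n :=
  [set A | integer_points G A /\ forall i j, exists m : nat, A i j = m%:R].

Definition submonoid : set (set 'M[C]_n) :=
  [set M | M 1%:M /\ forall A B, M A -> M B -> M (A *m B)].

Definition finitely_generated M : Prop :=
  exists2 X, finite_set X & M = smallest submonoid X.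

(* [f] restricts to a monoid morphism from [M] to [H]; its values outside [M]
   are irrelevant. *)
Definition monoid_hom_on M (H : groupType) (f : 'M[C]_n -> H) : Prop :=
  f 1%:M = 1%g /\ forall A B, M A -> M B -> f (A *m B) = (f A * f B)%g.

(* Universal property of the inclusion of the monoid [M] in the group [G]. *)
Definition is_group_completion M G : Prop :=
  [/\ is_subgroup G, submonoid M, M `<=` G &
      forall (H : groupType) (f : 'M[C]_n -> H), monoid_hom_on M f ->
        (exists2 g : 'M[C]_n -> H, monoid_hom_on G g & {in M, g =1 f}) /\
        (forall g h : 'M[C]_n -> H,
            monoid_hom_on G g -> {in M, g =1 f} ->
            monoid_hom_on G h -> {in M, h =1 f} -> {in G, g =1 h})].

Definition unipotent_numerical_monoid G S : Prop :=
  [/\ S `<=` natural_points G, submonoid S, finitely_generated S &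
      finite_set (natural_points G `\` S)].

Definition irreducible_monoid G S : Prop :=
  ~ exists T1 T2 : set 'M[C]_n,
      [/\ unipotent_numerical_monoid G T1, unipotent_numerical_monoid G T2,
          S `<` T1, S `<` T2 & T1 `&` T2 = S].

Definition nontrivial_part X : set 'M[C]_n := X `\ 1%:M.

Definition two_sided_frobenius G S : set 'M[C]_n :=
  [set A | [/\ natural_points G A, ~ nontrivial_part S A &
    [set A *m B | B in nontrivial_part (natural_points G)] `|`
    [set B *m A | B in nontrivial_part (natural_points G)] `<=` S]].

End UnipotentMonoids.

(* Main.v *)
Require Import Defs.
From mathcomp Require Import all_boot all_order all_algebra.
From mathcomp Require Import boolp classical_sets functions cardinality reals.
From mathcomp Require Import complex mpoly.
Local Open Scope ring_scope.
Local Open Scope complex_scope.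
Local Open Scope classical_set_scope.
Local Open Scope card_scope.

(* Multiplying a matrix of [G(N)] by a nontrivial element of [G(N)] strictly
   increases the sum of the entries, so a gap of [S] with the largest sum of
   entries is a two-sided Frobenius element.  Conversely, adjoining one such
   element [A] to [S] (when [S] is not all of [G(N)]) gives a unipotent
   numerical monoid [S `|` [set A]]; two distinct such [A] would present [S] as
   the intersection of two larger ones. *)

Import Order.TTheory GRing.Theory Num.Theory.

Lemma finite_set_argmax d (T : eqType) (U : orderType d) (w : T -> U)
    (D : set T) :
  finite_set D -> D !=set0 ->
  exists2 a, D a & forall x, D x -> (w x <= w a)%O.
Proof.
move=> /finite_seqP [s ->] {D}.
elim: s => [[x]//|y [|z s] IHs] _.
  by exists y => [|x]; rewrite /= ?inE // => /eqP ->.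
have [|a /= azs wa] := IHs; first by exists z; rewrite /= mem_head.
have [wya|way] := leP (w y) (w a).
  exists a => [|x]; rewrite /= [_ \in y :: _]in_cons ?azs ?orbT//.
  by move=> /orP [/eqP ->//|/wa].
exists y => [|x]; rewrite /= [_ \in y :: _]in_cons ?eqxx//.
move=> /orP [/eqP ->//|/wa wxa].
exact: le_trans wxa (ltW way).
Qed.

Section Frobenius.
Context {R : realType} {n : nat}.
Local Notation C := R[i].
Implicit Types (G S : set 'M[C]_n) (A B M K : 'M[C]_n).

(** The sum is kept in [C], where [<] also requires equal imaginary parts; a total order is obtained
    later by passing to real parts. *)
Definition entry_sum A : C := \sum_i \sum_j A i j.

Lemma entry_sumD A B : entry_sum (A + B) = entry_sum A + entry_sum B.
Proof.
rewrite -big_split; apply: eq_bigr => i _ /=.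
by rewrite -big_split; apply: eq_bigr => j _; rewrite mxE.
Qed.

Lemma entry_sum_ge0 M : (forall i j, 0 <= M i j) -> 0 <= entry_sum M.
Proof. by move=> M0; apply: sumr_ge0 => i _; apply: sumr_ge0. Qed.

Lemma entry_sum_gt0 M :
  (forall i j, 0 <= M i j) -> M != 0 -> 0 < entry_sum M.
Proof.
move=> M0 Mn0; rewrite lt_neqAle entry_sum_ge0// andbT eq_sym.
apply: contraNneq Mn0 => sM0; apply/eqP/matrixP => i j; rewrite mxE.
have Mi0 : \sum_j M i j = 0.
  by apply: (psumr_eq0P _ sM0) => // k _; apply: sumr_ge0.
by apply: (psumr_eq0P _ Mi0).
Qed.

(** Unipotency makes the diagonal of [A - 1%:M] vanish, so subtracting the identity creates no
    negative entry. *)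
Lemma natural_points_sub1_ge0 {G A} : G `<=` @unipotent_upper R n ->
  natural_points G A -> forall i j, 0 <= (A - 1%:M) i j.
Proof.
move=> GU [[/GU [A1 _] _] AN] i j; rewrite !mxE.
have [<-|_] := eqVneq i j; first by rewrite A1 subrr.
by have [m ->] := AN i j; rewrite subr0 ler0n.
Qed.

Lemma entry_sum_lt_add A M K :
  (forall i j, 0 <= M i j) -> (forall i j, 0 <= K i j) -> M != 0 ->
  entry_sum A < entry_sum (A + (M + K)).
Proof.
move=> M0 K0 Mn0; rewrite entry_sumD ltrDl entry_sumD.
by rewrite ltr_pwDl ?entry_sum_gt0 ?entry_sum_ge0.
Qed.

Lemma mulmx_nonneg A B : (forall i j, 0 <= A i j) -> (forall i j, 0 <= B i j) ->
  forall i j, 0 <= (A *m B) i j.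
Proof.
by move=> A0 B0 i j; rewrite mxE; apply: sumr_ge0 => k _; apply: mulr_ge0.
Qed.

(** With [I] the identity, AB = A + (B - I) + (A - I)(B - I), and BA is the same with the last two
    factors swapped. All added terms are entrywise nonnegative, and B - I is nonzero. *)
Lemma entry_sum_lt_mul {G A B} : G `<=` @unipotent_upper R n ->
  natural_points G A -> nontrivial_part (natural_points G) B ->
  entry_sum A < entry_sum (A *m B) /\ entry_sum A < entry_sum (B *m A).
Proof.
move=> GU GA [GB /eqP Bn1].
have A0 := natural_points_sub1_ge0 GU GA.
have B0 := natural_points_sub1_ge0 GU GB.
have Bn0 : B - 1%:M != 0 by rewrite subr_eq0.
have -> : A *m B =
    A + ((B - 1%:M) + (A - 1%:M) *m (B - 1%:M)).
  by rewrite mulmxBl mul1mx [_ - _ + _]addrC subrK mulmxBr mulmx1 addrC subrK.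
have -> : B *m A =
    A + ((B - 1%:M) + (B - 1%:M) *m (A - 1%:M)).
  by rewrite mulmxBr mulmx1 [_ - _ + _]addrC subrK mulmxBl mul1mx addrC subrK.
by split; apply: entry_sum_lt_add => //; apply: mulmx_nonneg.
Qed.

Lemma two_sided_frobenius_nonempty {G S} : G `<=` @unipotent_upper R n ->
  (forall A B, natural_points G A -> natural_points G B ->
    natural_points G (A *m B)) ->
  finite_set (natural_points G `\` S) -> natural_points G `\` S !=set0 ->
  two_sided_frobenius G S !=set0.
Proof.
move=> GU GM fin ne.
(* The order on [C] is only partial, while choosing a maximal gap requires a total one. *)
pose w X := complex.Re (entry_sum X).
have [A [GA SA] Amax] := finite_set_argmax _ _ _ w _ fin ne.
have mem_S X : natural_points G X -> entry_sum A < entry_sum X -> S X.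
  move=> GX; rewrite ltcE => /andP [_ ltAX]; apply: contrapT => SX.
  by have := Amax X (conj GX SX); rewrite leNgt /w ltAX.
exists A; split=> //; first by case.
by move=> _ [] [B BG <-]; have [ltl ltr] := entry_sum_lt_mul GU GA BG;
  apply: mem_S => //; apply: GM => //; case: BG.
Qed.

Lemma finitely_generated_setU1 {S A} : finitely_generated S ->
  submonoid (S `|` [set A]) -> finitely_generated (S `|` [set A]).
Proof.
move=> [X finX SE] subT; exists (X `|` [set A]).
  by rewrite finite_setU; split=> //; exact: finite_set1.
apply/seteqP; split=> [B SAB T [subT' XT]|].
  case: SAB => [|->]; last by apply: XT; right.
  by rewrite SE; apply; split=> // Y XY; apply: XT; left.
apply: smallest_sub => // Y [XY|->]; last by right.
by left; rewrite SE => T [_]; apply.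
Qed.

(** A product of [A] with an element of G(N) is [A] itself if that element is trivial, and otherwise
    lies in [S] by the Frobenius condition. *)
Lemma unipotent_numerical_monoid_setU1 {G S A} :
  unipotent_numerical_monoid G S -> A <> 1%:M -> two_sided_frobenius G S A ->
  unipotent_numerical_monoid G (S `|` [set A]).
Proof.
move=> [SG [S1 SM] Sfg Sfin] An1 [GA _ AS].
have subT : submonoid (S `|` [set A]).
  have AB B : natural_points G B -> (S `|` [set A]) (A *m B).
    move=> GB; have [->|/eqP Bn1] := eqVneq B 1%:M.
      by rewrite mulmx1; right.
    by left; apply: AS; left; exists B.
  have BA B : natural_points G B -> (S `|` [set A]) (B *m A).
    move=> GB; have [->|/eqP Bn1] := eqVneq B 1%:M.
      by rewrite mul1mx; right.
    by left; apply: AS; right; exists B.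
  split; first by left.
  move=> B D [SB|->] [SD|->].
  - by left; apply: SM.
  - exact/BA/SG.
  - exact/AB/SG.
  (* The remaining product is [A *m A], covered because [A] itself lies in G(N). *)
  - exact: AB.
split=> //.
- by move=> B [/SG|->].
- exact: finitely_generated_setU1.
- by apply: sub_finite_set Sfin => B [GB nSB]; split=> // SB; apply: nSB; left.
Qed.

Lemma irreducible_frobenius_unique {G S A B} :
  unipotent_numerical_monoid G S -> irreducible_monoid G S ->
  two_sided_frobenius G S A -> two_sided_frobenius G S B ->
  A <> 1%:M -> B <> 1%:M -> A = B.
Proof.
move=> Snum Sirr FA FB An1 Bn1; apply: contrapT => AB; apply: Sirr.
have proper D : D <> 1%:M -> two_sided_frobenius G S D -> S `<` S `|` [set D].
  move=> Dn1 [_ nSD _]; split=> [X SX|sub]; first by left.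
  by apply: nSD; split=> //; apply: sub; right.
exists (S `|` [set A]), (S `|` [set B]); split.
- exact: unipotent_numerical_monoid_setU1.
- exact: unipotent_numerical_monoid_setU1.
- exact: proper.
- exact: proper.
(* By distributivity the intersection is [S] together with the common part of two distinct
   singletons. *)
rewrite -setUIr; apply/seteqP; split=> X; last by left.
by move=> [//|[XA XB]]; case: AB; rewrite -XA -XB.
Qed.

End Frobenius.

Theorem theorem1p5 (R : realType) (n : nat) (n_gt0 : (0 < n)%N)
    (G : set 'M[R[i]]_n)
    (G_closed : closed_unipotent_subgroup G)
    (GN_fin_gen : finitely_generated (natural_points G))
    (GZ_completion : is_group_completion (natural_points G) (integer_points G))
    (S : set 'M[R[i]]_n)
    (S_num : unipotent_numerical_monoid G S)
    (S_irr : irreducible_monoid G S) :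
  two_sided_frobenius G S #= `I_1.
Proof.
have [GU _ _] := G_closed.
(* Closure of G(N) under products is read off from the group completion hypothesis. *)
have [_ [G1 GM] _ _] := GZ_completion.
have [SG [S1 _] _ Sfin] := S_num.
suff [A FE] : exists A, two_sided_frobenius G S = [set A].
  by rewrite FE; exact: card_set1.
(* If [S] is all of G(N), the only element outside its nontrivial part is the identity, which is
   then the unique Frobenius element. *)
have [GS|/nonsubset ne] := pselect (natural_points G `<=` S).
  exists 1%:M; apply/seteqP; split=> [A [GA nSA _]|_ ->] /=.
    by apply: contrapT => An1; apply: nSA; split=> //; exact: GS.
  split=> //; first by case=> _; apply.
  by move=> _ [] [B [GB _] <-]; rewrite ?mul1mx ?mulmx1; exact: GS.
(* Were the identity a Frobenius element, every nontrivial element of G(N) would lie in [S], leaving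
   no gap. *)
have n1 D : two_sided_frobenius G S D -> D <> 1%:M.
  move=> [_ _ DS] D1; have [X [GX nSX]] := ne; apply: (nSX).
  apply: DS; left; exists X; last by rewrite D1 mul1mx.
  by split=> // X1; apply: nSX; rewrite X1.
have [A FA] := two_sided_frobenius_nonempty GU GM Sfin ne.
exists A; apply/seteqP; split=> [B FB|_ ->] //=.
by apply: (irreducible_frobenius_unique S_num S_irr) => //; apply: n1.
Qed.
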